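(* Let $d\ge 3$ be fixed. Then $\chi^{\mathsf{w}}_{2d-3,d}(n)=\Omega\!\left(\dfrac{\log n}{\log\log n}\right)$ as $n\to\infty$; that is, there are constants $c_d>0$ and $n_d$ such that for all $n\ge n_d$ there is a $d$-uniform hypergraph on $n$ vertices, linearly embeddable into $\mathbb{R}^{2d-3}$, with weak chromatic number at least $c_d\log n/\log\log n$.
   Context: A $k$-uniform hypergraph $H=(V,E)$ consists of a finite set $V$ and $E\subseteq\binom{V}{k}$. A (linear) embedding of $H$ into $\mathbb{R}^d$ is a map $\phi:V(H)\to\mathbb{R}^d$ with $\dim\operatorname{aff}\phi(e)=k-1$ for every edge $e$ and $\operatorname{conv}\phi(e_1)\cap\operatorname{conv}\phi(e_2)=\operatorname{conv}\phi(e_1\cap e_2)$ for all edges $e_1,e_2$. $\mathcal{E}_{d,k}$ is the set of $k$-uniform hypergraphs admitting such an embedding into $\mathbb{R}^d$. A weak $c$-coloring of $H$ is a map $\kappa:V(H)\to\{1,\dots,c\}$ with $|\kappa(e)|>1$ for every edge $e$; $\chi^{\mathsf{w}}(H)$ is the least such $c$. $\chi^{\mathsf{w}}_{d,k}(n)=\max\{\chi^{\mathsf{w}}(H): H\in\mathcal{E}_{d,k},\ |V(H)|=n\}$. *)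

(* Defs.v *)
From Stdlib Require Import Reals.
From mathcomp Require Import all_boot.

Set Implicit Arguments.
Unset Strict Implicit.
Unset Printing Implicit Defensive.

Local Open Scope R_scope.

Definition point (D : nat) := 'I_D -> R.

Definition uniform (n k : nat) (E : {set {set 'I_n}}) : Prop :=
  forall e, e \in E -> #|e| = k.

Definition in_conv (n D : nat) (phi : 'I_n -> point D) (e : {set 'I_n})
  (x : point D) : Prop :=
  exists lam : 'I_n -> R,
    (forall v, 0 <= lam v) /\
    (forall v, v \notin e -> lam v = 0) /\
    \big[Rplus/0]_(v in e) lam v = 1 /\
    (forall j : 'I_D, x j = \big[Rplus/0]_(v in e) (lam v * phi v j)).

(* The points phi v (v in e) are affinely independent (as an indexed family):
   the only affine dependence among them is trivial. For a k-set e this is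
   exactly "dim aff phi(e) = k - 1". *)
Definition aff_indep (n D : nat) (phi : 'I_n -> point D) (e : {set 'I_n}) : Prop :=
  forall mu : 'I_n -> R,
    \big[Rplus/0]_(v in e) mu v = 0 ->
    (forall j : 'I_D, \big[Rplus/0]_(v in e) (mu v * phi v j) = 0) ->
    forall v, v \in e -> mu v = 0.

Definition lin_embedding (n D : nat) (E : {set {set 'I_n}}) (phi : 'I_n -> point D)
  : Prop :=
  (forall e, e \in E -> aff_indep phi e) /\
  (forall e1 e2, e1 \in E -> e2 \in E ->
     forall x : point D,
       (in_conv phi e1 x /\ in_conv phi e2 x) <-> in_conv phi (e1 :&: e2) x).

Definition embeddable (n D k : nat) (E : {set {set 'I_n}}) : Prop :=
  uniform k E /\ exists phi : 'I_n -> point D, lin_embedding E phi.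

Definition weak_coloring (n c : nat) (E : {set {set 'I_n}}) (kappa : 'I_n -> 'I_c)
  : Prop :=
  forall e, e \in E -> exists u v, u \in e /\ v \in e /\ kappa u <> kappa v.

Definition weak_chi_ge (n : nat) (E : {set {set 'I_n}}) (m : R) : Prop :=
  forall (c : nat) (kappa : 'I_n -> 'I_c), weak_coloring E kappa -> m <= INR c.

(* Main.v *)
Require Import Defs.
From Stdlib Require Import Reals Lra.
From mathcomp Require Import all_boot.
From mathcomp Require Import all_order all_algebra boolp Rstruct.
From mathcomp Require Import zify ring lra.

(* Put the vertices on the moment curve of R^(2d-3). A non-zero weight vector whose
   moments of order at most 2d-3 vanish changes sign at least 2d-2 times along the
   curve, so two d-simplices e and f meet outside their common face only if one of
   them has a vertex in each gap between consecutive vertices of the other. Hence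
   any ordered d-graph without such an interlacing pair is embedded.

   An interlace-free d-graph defeating C+1 colors is built from one defeating C
   colors. Take m = (d-2)(C+1)+1 points; right after each point v, put for every
   point u a copy W(u,v) of the smaller d-graph, by increasing u. The new edges are
   S + w with S a set of d-1 points and w in W(min S, max S). By pigeonhole some S
   has a single color k; if no S + w is monochromatic, then W(min S, max S) avoids k
   and is colored with C colors. The number of vertices N satisfies
   N(C+1) = m (1 + m N(C)), so log N(C) = O(C log C). *)

Set Implicit Arguments.
Unset Strict Implicit.
Unset Printing Implicit Defensive.

Import Order.TTheory GRing.Theory Num.Theory.

Delimit Scope R_scope with Re.

(** * Interlace-free ordered hypergraphs *)

Definition interlaces (f e : seq nat) : Prop :=
  forall i, i.+1 < size e ->
    exists2 y, y \in f & nth 0 e i < y < nth 0 e i.+1.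

Definition interlace_free (F : seq nat -> Prop) : Prop :=
  forall e f, F e -> F f -> ~ interlaces f e.

Definition ordered_uniform (d N : nat) (F : seq nat -> Prop) : Prop :=
  forall e, F e -> [/\ sorted ltn e, size e = d & all (gtn N) e].

(** The palette is a list [K] rather than a range of numbers, so that the induction on [C] can
    delete any one color from it. *)
Definition forces_mono (C N : nat) (F : seq nat -> Prop) : Prop :=
  forall (kappa : nat -> nat) (K : seq nat), size K <= C ->
    (forall v, v < N -> kappa v \in K) ->
    exists e k, F e /\ all (fun v => kappa v == k) e.

(* Blocks of length [m * N + 1]: the point [v] is at [v * (m * N + 1)], followed by
   the copies W(0,v), ..., W(m-1,v); [slot m N u v] is the first vertex of W(u,v). *)
Definition slot (m N u v : nat) : nat := v * (m * N).+1 + (u * N).+1.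

Inductive blowup (q m N : nat) (F : seq nat -> Prop) : seq nat -> Prop :=
| Blowup_copy u v e : u < m -> v < m -> F e ->
    blowup q m N F (map (addn (slot m N u v)) e)
| Blowup_cone S w : sorted ltn S -> size S = q.+1 -> all (gtn m) S -> w < N ->
    blowup q m N F
      (rcons (map (muln^~ (m * N).+1) S)
             (slot m N (head 0 S) (last 0 S) + w)).

Lemma slot_bounds m N u v w : u < m -> w < N ->
  v * (m * N).+1 < slot m N u v + w < v.+1 * (m * N).+1.
Proof.
move=> um wN; rewrite /slot.
have : u.+1 * N <= m * N by rewrite leq_mul2r um orbT.
rewrite !mulSn; lia.
Qed.

Lemma slot_inj m N u v w u' v' w' : u < m -> w < N -> u' < m -> w' < N ->
  slot m N u v + w = slot m N u' v' + w' -> [/\ u = u', v = v' & w = w'].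
Proof.
move=> um wN um' wN' E.
have /andP[b1 b2] := slot_bounds v um wN.
have /andP[b1' b2'] := slot_bounds v' um' wN'.
have vv : v = v'.
  rewrite E in b1 b2; have := ltn_trans b1 b2'; have := ltn_trans b1' b2.
  by rewrite !ltn_pmul2r // !ltnS => ? ?; apply/eqP; rewrite eqn_leq; apply/andP.
subst v'; have E' : u * N + w = u' * N + w' by move: E; rewrite /slot; lia.
have N0 : 0 < N by lia.
have uu : u = u'.
  by have := congr1 (divn^~ N) E'; rewrite /= !divnMDl // !divn_small // !addn0.
by split=> //; subst u'; lia.
Qed.

Lemma slot_neq_mul m N u v w x : u < m -> w < N ->
  slot m N u v + w <> x * (m * N).+1.
Proof.
move=> um wN E; have := slot_bounds v um wN.
by rewrite E !ltn_pmul2r //; lia.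
Qed.

Lemma mem_cone m N S w y :
  y \in rcons (map (muln^~ (m * N).+1) S) (slot m N (head 0 S) (last 0 S) + w) ->
  (exists2 x, x \in S & y = x * (m * N).+1) \/
  y = slot m N (head 0 S) (last 0 S) + w.
Proof.
rewrite mem_rcons inE => /orP[/eqP -> | /mapP[x xS ->]]; first by right.
by left; exists x.
Qed.

Lemma mem_copy m N u v F d e y : ordered_uniform d N F -> F e ->
  y \in map (addn (slot m N u v)) e ->
  exists2 w, w \in e /\ w < N & y = slot m N u v + w.
Proof.
move=> FU Fe /mapP[w we ->]; exists w => //; split=> //.
by case: (FU _ Fe) => _ _ /allP /(_ _ we).
Qed.

(** If the [i]-th entry of [f] is at most that of [e], the vertex of [f] in the next gap of [e]
    comes later in [f], so the [i.+1]-st entry of [f] is at most that vertex. *)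
Lemma interlaces_nth_lt e f : sorted ltn f -> interlaces f e ->
  nth 0 f 0 <= nth 0 e 0 ->
  forall i, i.+1 < size e -> nth 0 f i.+1 < nth 0 e i.+1.
Proof.
move=> sf ief h0 i hi.
have mono j k : j < k < size f -> nth 0 f j < nth 0 f k.
  by move=> /andP[jk kf]; apply: (sorted_ltn_nth ltn_trans) => //;
     rewrite inE // (ltn_trans jk kf).
have step j : j.+1 < size e -> nth 0 f j <= nth 0 e j ->
    nth 0 f j.+1 < nth 0 e j.+1.
  move=> hj le; have [y yf /andP[y1 y2]] := ief j hj; apply: leq_ltn_trans y2.
  (* When [f] is too short, the default value 0 is at most [y]. *)
  have [sz|sz] := leqP (size f) j.+1; first by rewrite nth_default.
  have [k kf Dy] : exists2 k, k < size f & y = nth 0 f k.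
    by exists (index y f); rewrite ?index_mem // nth_index.
  rewrite {}Dy in y1 *; have [|lt] := leqP j.+1 k.
    by rewrite leq_eqVlt => /orP[/eqP <- //|lt]; apply: ltnW; apply: mono; lia.
  suff : nth 0 f k <= nth 0 f j by lia.
  by move: lt; rewrite ltnS leq_eqVlt => /orP[/eqP -> //|lt];
     apply: ltnW; apply: mono; lia.
by elim: i hi => [|i IH] hi; apply: step => //; apply: ltnW; apply: IH; lia.
Qed.

Lemma blowup_uniform q m N F : ordered_uniform q.+2 N F ->
  ordered_uniform q.+2 (m * (m * N).+1) (blowup q m N F).
Proof.
move=> FU e; case=> {e} [u v e um vm Fe|S w sS szS aS wN].
  have [se ze /allP ae] := FU _ Fe; split; rewrite ?size_map //.
    by rewrite sorted_map; apply: sub_sorted se => i j; rewrite /= ltn_add2l.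
  apply/allP => _ /mapP[w we ->] /=.
  have /andP[_ b] := slot_bounds v um (ae _ we).
  by apply: leq_trans b _; rewrite leq_mul2r vm orbT.
have S0 : 0 < size S by rewrite szS.
have lS : last 0 S \in S by case: (S) S0 => //= a l _; exact: mem_last.
have hS : head 0 S \in S by case: (S) S0 => //= a l _; exact: mem_head.
have hm : head 0 S < m by exact: (allP aS).
have lm : last 0 S < m by exact: (allP aS).
have /andP[b1 b2] := slot_bounds (last 0 S) hm wN.
split; rewrite ?size_rcons ?size_map ?szS //.
  have sS' : sorted ltn (map (muln^~ (m * N).+1) S).
    by rewrite sorted_map; apply: sub_sorted sS => i j; rewrite /= ltn_pmul2r.
  case: (S) S0 sS' b1 => //= a l _ sS' b1.
  rewrite rcons_path sS' (_ : last _ _ = last a l * (m * N).+1) //.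
  exact: (last_map (muln^~ (m * N).+1)).
apply/allP => y /mem_cone[[x xS ->]|->] /=.
  by rewrite ltn_pmul2r //; exact: (allP aS).
by apply: leq_trans b2 _; rewrite leq_mul2r lm orbT.
Qed.

(** An edge of size at least 3 has two gaps, so [f] has two vertices within the range of one copy
    W(u,v); a cone edge has only one vertex off the multiples of the block length. *)
Lemma interlaces_copy m N u v F d e f : 2 < d -> ordered_uniform d N F -> F e ->
  interlaces f (map (addn (slot m N u v)) e) ->
  exists y1 y2 w1 w2, [/\ y1 \in f, y2 \in f & y1 < y2] /\
    [/\ w1 < N, w2 < N, y1 = slot m N u v + w1 & y2 = slot m N u v + w2].
Proof.
move=> d2 FU Fe ief; have [se ze ae] := FU _ Fe.
have eN i : i < d -> nth 0 e i < N by move=> ?; apply: (all_nthP 0 ae); rewrite ze.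
have gap i : i.+1 < d -> exists2 y, y \in f &
    slot m N u v + nth 0 e i < y < slot m N u v + nth 0 e i.+1.
  move=> hi; have [|y yf] := ief i; rewrite ?size_map ?ze //.
  by rewrite !(nth_map 0) ?ze ?(ltnW hi) //; exists y.
have [y1 y1f /andP[a1 b1]] := gap 0 (ltnW d2).
have [y2 y2f /andP[a2 b2]] := gap 1 d2.
have := eN 1 (ltnW d2); have := eN 2 d2 => ? ?.
exists y1, y2, (y1 - slot m N u v), (y2 - slot m N u v).
by do 2!split=> //; lia.
Qed.

Lemma nth_cone m N S x i :
  nth 0 (rcons (map (muln^~ (m * N).+1) S) x) i =
  if i < size S then nth 0 S i * (m * N).+1 else if i == size S then x else 0.
Proof.
rewrite nth_rcons size_map; case: ltnP => // h.
by rewrite (nth_map 0).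
Qed.

Lemma blowup_interlace_free q m N F : 0 < q -> ordered_uniform q.+2 N F ->
  interlace_free F -> interlace_free (blowup q m N F).
Proof.
move=> q0 FU FI e f Be Bf ief; have BU := blowup_uniform (m := m) FU.
have [sf _ _] := BU _ Bf.
case: Be ief => {e} [u v e um vm Fe|S w sS szS aS wN] ief.
  have [y1 [y2 [w1 [w2 [[y1f y2f y12] [w1N w2N E1 E2]]]]]] :=
    interlaces_copy (d := q.+2) q0 FU Fe ief.
  case: Bf ief y1f y2f {sf} => {f} [u' v' f um' vm' Ff|S w sS szS aS wN] ief.
    move=> /(mem_copy FU Ff)[w' [_ w'N] E] _.
    have [uu vv _] := slot_inj um' w'N um w1N (etrans (esym E) E1); subst u' v'.
    case: (FI e f Fe Ff) => i hi; have [|y] := ief i; rewrite ?size_map //.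
    move=> /mapP[z zf ->]; rewrite !(nth_map 0) ?(ltnW hi) // !ltn_add2l.
    by exists z.
  have no_mul w3 x : w3 < N -> slot m N u v + w3 = x * (m * N).+1 -> False.
    by move=> ? /slot_neq_mul; apply.
  move=> /mem_cone[[x _ E]|E]; first by case: (no_mul _ x w1N); rewrite -E1 E.
  move=> /mem_cone[[x _ E']|E']; first by case: (no_mul _ x w2N); rewrite -E2 E'.
  by move: y12; rewrite E E' ltnn.
set B := (m * N).+1 in ief *.
have lS : last 0 S = nth 0 S q by rewrite -nth_last szS.
have hm : head 0 S < m by rewrite -nth0; apply: (all_nthP 0 aS); rewrite szS.
(* The last gap of the cone, from the last point of [S] to the apex, lies inside one block, so [yl]
   is not a multiple of the block length [B]. *)
have [|yl] := ief q; first by rewrite size_rcons size_map szS.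
rewrite !nth_cone szS ltnSn ltnn eqxx.
rewrite -lS => ylf /andP[yl1 yl2].
have /andP[_ top] := slot_bounds (last 0 S) hm wN.
have yl3 := ltn_trans yl2 top.
(* A copy stays in a single block, but [f] would meet both the first gap, which ends at the second
   point of [S], and the block of the last point of [S]. *)
case: Bf ief ylf sf => {f} [u v f um vm Ff|S' w' sS' szS' aS' wN'] ief ylf sf.
  have [|y0] := ief 0; first by rewrite size_rcons size_map szS.
  rewrite !nth_cone szS /= ltnS q0.
  move=> y0f /andP[_ y01].
  have [w0 [_ w0N] E0] := mem_copy FU Ff y0f.
  have [w3 [_ w3N] E3] := mem_copy FU Ff ylf.
  have /andP[b0 _] := slot_bounds v um w0N; have /andP[_ b3] := slot_bounds v um w3N.
  rewrite -E0 in b0; rewrite -E3 in b3.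
  have := ltn_trans b0 y01; have := ltn_trans yl1 b3; rewrite !ltn_pmul2r // lS => h1 h2.
  have : nth 0 S 1 <= nth 0 S q.
    case: (ltngtP 1 q) => [h|h|<- //]; last by lia.
    by apply: ltnW; apply: (sorted_ltn_nth ltn_trans); rewrite ?inE ?szS.
  lia.
have hm' : head 0 S' < m by rewrite -nth0; apply: (all_nthP 0 aS'); rewrite szS'.
have /andP[bot' top'] := slot_bounds (last 0 S') hm' wN'.
case/mem_cone: (ylf) => [[x _ E]|E].
  by move: yl1 yl3; rewrite E !ltn_pmul2r //; lia.
have ll : last 0 S' = last 0 S.
  rewrite E in yl1 yl3; have := ltn_trans yl1 top'; have := ltn_trans bot' yl3.
  by rewrite !ltn_pmul2r //; lia.
(* With a common last point, [f] would be strictly below [e] at position [q], where both entries are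
   that last point. *)
have [le|lt] := leqP (head 0 S') (head 0 S).
  have := interlaces_nth_lt sf ief _ (i := q.-1).
  rewrite prednK // !nth_cone szS szS' !ltnSn !ltn0Sn !nth0 leq_mul2r le orbT.
  by rewrite size_rcons size_map szS -lS -ll -nth_last szS' /= ltnn => /(_ isT (leqnSn _)).
(* Copies come by increasing first index, so the apex [yl] of [f] lies beyond the apex of [e], not
   in the last gap. *)
move: yl2; rewrite E ll /slot.
have : (head 0 S).+1 * N <= head 0 S' * N by rewrite leq_mul2r lt orbT.
by rewrite mulSn; lia.
Qed.

Lemma pigeonhole_count (kappa : nat -> nat) q (K s : seq nat) :
  (forall x, x \in s -> kappa x \in K) -> size K * q < size s ->
  exists2 k, k \in K & q < count (fun x => kappa x == k) s.
Proof.
elim: K s => [|a K IH] s sK szs; first by case: s sK szs => // x s /(_ x (mem_head _ _)).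
have [lt|le] := ltnP q (count (fun x => kappa x == a) s).
  by exists a; rewrite ?mem_head.
have [||k kK lt] := IH [seq x <- s | kappa x != a].
- by move=> x; rewrite mem_filter => /andP[na /sK]; rewrite inE (negPf na).
- rewrite size_filter; move: szs; rewrite /= mulSn.
  have <- : count (fun x => kappa x == a) s + count (fun x => kappa x != a) s = size s.
    exact: count_predC.
  lia.
exists k; first by rewrite inE kK orbT.
by apply: leq_trans lt _; rewrite count_filter; apply: sub_count => x /andP[].
Qed.

Lemma blowup_forces q C N F : 
  let m := (q * C.+1).+1 in
  ordered_uniform q.+2 N F -> forces_mono C N F ->
  forces_mono C.+1 (m * (m * N).+1) (blowup q m N F).
Proof.
move=> m FU FC kappa K szK inK.
have N0m x : x < m -> x * (m * N).+1 < m * (m * N).+1 by rewrite ltn_pmul2r.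
have [||k kK lt] := @pigeonhole_count (fun x => kappa (x * (m * N).+1)) q K (iota 0 m).
- by move=> x; rewrite mem_iota add0n => /N0m /inK.
- by rewrite size_iota /m ltnS mulnC leq_mul2l szK orbT.
set T := [seq x <- iota 0 m | kappa (x * (m * N).+1) == k].
set S := take q.+1 T.
have szS : size S = q.+1 by rewrite size_takel // size_filter.
have ST x : x \in S -> x < m /\ kappa (x * (m * N).+1) = k.
  by move=> /mem_take; rewrite mem_filter mem_iota => /andP[/eqP -> /andP[_ ->]].
have sS : sorted ltn S.
  by apply: take_sorted; apply: sorted_filter (iota_ltn_sorted _ _); exact: ltn_trans.
have lS : last 0 S \in S by case: (S) szS => //= a l _; exact: mem_last.
have hS : head 0 S \in S by case: (S) szS => //= a l _; exact: mem_head.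
have [hm _] := ST _ hS; have [lm _] := ST _ lS.
pose kw w := kappa (slot m N (head 0 S) (last 0 S) + w).
have kwK w : w < N -> kw w \in K.
  move=> wN; apply: inK; have /andP[_ b] := slot_bounds (last 0 S) hm wN.
  by apply: leq_trans b _; rewrite leq_mul2r lm orbT.
have [/hasP[w]|/hasPn avoid] := boolP (has (fun w => kw w == k) (iota 0 N)).
  rewrite mem_iota add0n => wN /eqP kwk.
  exists (rcons (map (muln^~ (m * N).+1) S) (slot m N (head 0 S) (last 0 S) + w)), k.
  split; first by constructor=> //; apply/allP => x /ST[].
  rewrite all_rcons -/(kw w) kwk eqxx all_map; apply/allP => x /ST[_ /= ->]; exact: eqxx.
have [||e [k' [Fe ae]]] := FC kw (rem k K).
- by move: szK; rewrite size_rem //; case: (size K).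
- move=> w wN; have := kwK w wN; rewrite (perm_mem (perm_to_rem kK)) inE.
  by rewrite (negPf (avoid w _)) // mem_iota.
by exists (map (addn (slot m N (head 0 S) (last 0 S))) e), k'; split;
  [constructor | rewrite all_map].
Qed.

(** * Iterated blow-up and its number of vertices *)

Fixpoint order_of (q C : nat) : nat :=
  if C is C'.+1 then
    let m := (q * C).+1 in m * (m * order_of q C').+1
  else 1.

Fixpoint hyper (q C : nat) : seq nat -> Prop :=
  if C is C'.+1 then blowup q (q * C).+1 (order_of q C') (hyper q C')
  else fun _ => False.

Lemma hyperP q C : 0 < q ->
  [/\ ordered_uniform q.+2 (order_of q C) (hyper q C),
      interlace_free (hyper q C)
    & forces_mono C (order_of q C) (hyper q C)].
Proof.
move=> q0; elim: C => [|C [U I M]].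
  (* One vertex and no edge serve for zero colors: an empty palette cannot color vertex 0, whereas
     without vertices it would color everything. *)
  split=> // kappa K; rewrite leqn0 size_eq0 => /eqP -> /(_ 0 isT).
  by rewrite in_nil.
split; [exact: blowup_uniform | exact: blowup_interlace_free | exact: blowup_forces].
Qed.

Lemma ltn_order_of q C : C < order_of q C.
Proof. by elim: C => //= C IH; rewrite mulSn !mulSn; lia. Qed.

(** One blow-up turns N into m + m^2 N, at most 2 m^2 N, and m is at most (q + 2)(C + 1); these
    factors grow with [C], so the last one bounds them all. *)
Lemma order_of_le q C : order_of q C <= (2 * q.+2 ^ 2 * C ^ 2) ^ C.
Proof.
elim: C => // C IH; have := ltn_order_of q C => N0.
have le1 : order_of q C.+1 <= 2 * q.+2 ^ 2 * C.+1 ^ 2 * order_of q C.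
  have -> : 2 * q.+2 ^ 2 * C.+1 ^ 2 = 2 * (q.+2 * C.+1) ^ 2 by rewrite expnMn mulnA.
  rewrite /=; have : (q * C.+1).+1 <= q.+2 * C.+1 by lia.
  move: (q * C.+1).+1 (order_of q C) N0 (q.+2 * C.+1) => m N N0 p mp.
  have mp2 : m * m <= p ^ 2 by rewrite -mulnn leq_mul.
  have : m * m * N <= p ^ 2 * N by rewrite leq_mul2r mp2 orbT.
  have : m <= m * m * N by case: (m) => // k; rewrite -mulnA leq_pmulr // muln_gt0; lia.
  by rewrite mulnS -!mulnA; lia.
apply: leq_trans le1 _; rewrite [leqRHS]expnS leq_mul2l; apply/orP; right.
apply: leq_trans IH _; case: C {N0} => // C.
by rewrite leq_exp2r // leq_mul2l leq_exp2r // leqnSn orbT.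
Qed.

(** For [n] between two consecutive orders, the smaller hypergraph is used with extra isolated
    vertices, and the larger order bounds [n] from above. *)
Lemma order_of_bracket q n : 0 < n -> exists C, order_of q C <= n < order_of q C.+1.
Proof.
move=> n0; have ex0 : exists C, order_of q C <= n by exists 0.
have ub C : order_of q C <= n -> C <= n.
  by move=> h; apply: leq_trans h; apply: ltnW; exact: ltn_order_of.
case: (ex_maxnP ex0 ub) => C hC maxC; exists C; rewrite hC ltnNge.
by apply/negP => /maxC; rewrite ltnn.
Qed.

(** * Sign changes and the moment curve *)

(* A chain of [k] indices, all at least [lo], with alternating signs of [nu],
   starting with a positive value if [b = false]. *)
Fixpoint alternates (R : numDomainType) (nu : nat -> R) (k : nat) (b : bool)
    (lo : nat) : Prop :=
  if k is k'.+1 then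
    exists i, [/\ lo <= i, (0 < (-1) ^+ b * nu i)%R & alternates nu k' (~~ b) i.+1]
  else True.

Lemma alternates_trunc (R : numDomainType) (nu : nat -> R) k b lo :
  alternates nu k.+1 b lo -> alternates nu k b lo.
Proof.
elim: k b lo => // k IH b lo [i [loi bi alt]].
by exists i; split=> //; apply: IH.
Qed.

Lemma alternates_sub (R : numDomainType) (nu nu' : nat -> R) k b lo :
  (forall (i : nat) (c : bool), (lo <= i)%N -> 0 < (-1) ^+ c * nu i -> 0 < (-1) ^+ c * nu' i)%R ->
  alternates nu k b lo -> alternates nu' k b lo.
Proof.
elim: k b lo => // k IH b lo sub [i [loi bi alt]].
exists i; split=> //; first exact: sub.
by apply: IH alt => j c /ltnW ij; apply: sub; apply: leq_trans ij.
Qed.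

(** [i0] is the first index of non-zero weight, [b] records its sign, and [i1] is the first index of
    opposite sign; it exists because non-negative terms with sum zero all vanish. *)
Lemma sum0_sign_change (R : realDomainType) n (nu : nat -> R) :
  (\sum_(i < n) nu i = 0)%R -> (exists2 i, i < n & nu i != 0%R) ->
  exists (b : bool) i0 i1, [/\ i0 < i1, (0 < (-1) ^+ b * nu i0)%R,
    (forall i, i < i1 -> (0 <= (-1) ^+ b * nu i)%R), i1 < n & ((-1) ^+ b * nu i1 < 0)%R].
Proof.
move=> s0 ex0.
have exP : exists i, (i < n) && (nu i != 0)%R.
  by have [i i1 i2] := ex0; exists i; rewrite i1.
case: (ex_minnP exP) => i0 /andP[i0n nz0] min0.
pose b := (nu i0 < 0)%R.
have pos0 : (0 < (-1) ^+ b * nu i0)%R.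
  rewrite /b; case: (ltgtP (nu i0) 0%R) nz0 => // h _; rewrite ?expr1 ?expr0; lra.
have exN : exists i, (i < n) && ((-1) ^+ b * nu i < 0)%R.
  apply: contrapT => nex.
  have ge0 (i : 'I_n) : (0 <= (-1) ^+ b * nu i)%R.
    by rewrite leNgt; apply/negP => h; apply: nex; exists i; rewrite ltn_ord.
  have : (\sum_(i < n) (-1) ^+ b * nu i == 0)%R by rewrite -mulr_sumr s0 mulr0.
  rewrite psumr_eq0 // => /allP /(_ (Ordinal i0n)); rewrite mem_index_enum => /(_ isT) /=.
  by move=> /eqP h; rewrite h ltxx in pos0.
case: (ex_minnP exN) => i1 /andP[i1n neg1] min1.
have le1 i : i < i1 -> (0 <= (-1) ^+ b * nu i)%R.
  move=> ii; rewrite leNgt; apply/negP => h.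
  by have := min1 i; rewrite h (ltn_trans ii i1n) => /(_ isT); lia.
exists b, i0, i1; split=> //.
have [//|lt|E] := ltngtP i0 i1; last by rewrite E in pos0; have := lt_trans pos0 neg1; rewrite ltxx.
have := min0 i1; rewrite i1n (_ : nu i1 != 0)%R; first by move=> /(_ isT); lia.
by apply/eqP => h; rewrite h mulr0 ltxx in neg1.
Qed.

(* Multiplying the weights by [2 (i - i1) + 1], where [i1] is the position of the
   first sign change, removes that sign change at the cost of one moment. *)
Lemma moments_alternates (R : realDomainType) n D (nu : nat -> R) :
  (forall j, j <= D -> (\sum_(i < n) nu i * i%:R ^+ j = 0)%R) ->
  (exists2 i, i < n & nu i != 0%R) -> exists b, alternates nu D.+2 b 0.
Proof.
elim: D nu => [|D IH] nu mom ex0.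
all: have [|b [i0 [i1 [i01 pos0 nonneg i1n neg1]]]] := sum0_sign_change _ ex0.
- by rewrite -[RHS](mom 0) //; apply: eq_bigr => i _; rewrite expr0 mulr1.
- exists b; exists i0; split=> //; exists i1; split=> //.
  by rewrite signrN mulNr oppr_gt0.
- by rewrite -[RHS](mom 0) //; apply: eq_bigr => i _; rewrite expr0 mulr1.
(* The factor is an odd integer, hence never zero: negative before [i1], positive from [i1] on. *)
pose nu' i : R := ((i%:R *+ 2 - i1%:R *+ 2 + 1) * nu i)%R.
have fneg i : i < i1 -> (i%:R *+ 2 - i1%:R *+ 2 + 1 < 0 :> R)%R.
  by move=> ii; have : (i%:R + 1 <= i1%:R :> R)%R; [rewrite natr1 ler_nat | lra].
have fpos i : i1 <= i -> (0 < i%:R *+ 2 - i1%:R *+ 2 + 1 :> R)%R.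
  by rewrite -(ler_nat R); lra.
have [||b' [a [_ a_pos alt]]] := IH nu'.
- move=> j jD.
  transitivity (2 * \sum_(i < n) nu i * i%:R ^+ j.+1 +
                (1 - i1%:R *+ 2) * \sum_(i < n) nu i * i%:R ^+ j)%R.
    rewrite !mulr_sumr -big_split; apply: eq_bigr => i _.
    by rewrite /nu' exprS /=; ring.
  by rewrite !mom ?mulr0 ?addr0 //; lia.
- exists i0; first exact: ltn_trans i1n.
  rewrite /nu' mulf_neq0 //; first by rewrite lt_eqF // fneg.
  by apply/eqP => h; rewrite h mulr0 ltxx in pos0.
have {}alt : alternates nu' D.+1 (~~ b') a.+1 := alt.
(* Before [i1], [nu] has sign [b] or vanishes, so [nu'] can only have the opposite sign there. *)
have before i (c : bool) : i < i1 -> (0 < (-1) ^+ c * nu' i)%R -> c = ~~ b.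
  move=> ii; have := nonneg i ii; have := fneg i ii; rewrite /nu' mulrCA => h1 h2.
  rewrite nmulr_rgt0 // => h3.
  have [E|nE] := eqVneq c b; last by case: (c) (b) nE => [] [].
  by rewrite E in h3; have := le_lt_trans h2 h3; rewrite ltxx.
have after i (c : bool) : i1 <= i -> (0 < (-1) ^+ c * nu' i)%R -> (0 < (-1) ^+ c * nu i)%R.
  by move=> ii; rewrite /nu' mulrCA pmulr_rgt0 // fpos.
have not1 i : i1 <= i -> (0 < (-1) ^+ b * nu' i)%R -> i1 < i.
  move=> ii /after => /(_ ii) h; rewrite ltn_neqAle ii andbT; apply/eqP => E.
  by rewrite E in neg1; have := lt_trans h neg1; rewrite ltxx.
(* Either way the chain reaches length [D.+3]: [i0] followed by [D.+2] indices, or [i0] and [i1]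
   followed by [D.+1]. *)
suff [alt'|alt'] : alternates nu D.+2 (~~ b) i1 \/ alternates nu D.+1 b i1.+1.
- exists b, i0; split=> //; case: alt' => i [ii bi alt']; exists i; split=> //.
  exact: leq_trans ii.
- exists b, i0; split=> //; exists i1; split=> //; last by rewrite negbK.
  by rewrite signrN mulNr oppr_gt0.
(* If the chain of [nu'] starts before [i1], its first sign is opposite to [b]; the next index has
   sign [b], hence lies after [i1]. *)
have [ai|ia] := ltnP a i1.
  have Db := before _ _ ai a_pos; subst b'; right.
  case: alt => a1; rewrite negbK => -[aa1 a1_pos alt].
  have ia1 : i1 <= a1.
    by rewrite leqNgt; apply/negP => h; have := before _ _ h a1_pos; case: (b).
  exists a1; split; [exact: not1 | exact: after|].
  by apply: alternates_sub alt => j c aj; apply: after; lia.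
(* Now the whole chain lies from [i1] on. Starting opposite to [b], it continues [i0]; starting with
   [b], it continues [i0], [i1] and loses its last index. *)
have [E|nE] := eqVneq b' b; last first.
  left; exists a; have <- : b' = ~~ b by case: (b') (b) nE => [] [].
  by split=> //; [exact: after | apply: alternates_sub alt => j c aj; apply: after; lia].
subst b'; right; exists a; split; [exact: not1 | exact: after|].
apply: alternates_trunc.
by apply: alternates_sub alt => j c aj; apply: after; lia.
Qed.

(** The chain has [k.+1] indices in [e], separated by [k] indices in [f]; when [e] has only [k.+1]
    elements, these separators meet every gap. *)
Lemma alternates_interlaces (R : numDomainType) (nu : nat -> R) k (b : bool) lo e f :
  sorted ltn e ->
  (forall i, lo <= i -> (0 < (-1) ^+ b * nu i)%R -> i \in e) ->
  (forall i, lo <= i -> (0 < (-1) ^+ (~~ b) * nu i)%R -> i \in f) ->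
  alternates nu k.*2.+1 b lo ->
  k < size e /\ (size e = k.+1 -> lo <= nth 0 e 0 /\ interlaces f e).
Proof.
elim: e k lo => [|x e IH] k lo; first by move=> _ sub _ [i [/sub h /h]].
move=> /= se sube subf alt; have [a [loa pa alta]] := alt.
have se' := path_sorted se.
have xlt y : y \in e -> x < y.
  by move: se; rewrite (path_sortedE ltn_trans) => /andP[/allP h _] /h.
(* If the chain does not start at the head [x], it fits in the tail, so the whole list has more than
   [k.+1] elements and the second claim is void. *)
have := sube _ loa pa; rewrite inE => /orP[/eqP ax|ae]; last first.
  have [||||lt _] := IH k a => //.
  - move=> i ai pi; have := sube i (leq_trans loa ai) pi; rewrite inE.
    by case/orP => // /eqP ix; have := xlt _ ae; lia.
  - by move=> i ai; apply: subf; apply: leq_trans ai.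
  - by exists a.
  by split; [exact: leq_trans lt _ | lia].
subst a; case: k alt alta => [|k] alt alta.
  by split=> // -[/size0nil ->]; split.
rewrite doubleS in alta; case: alta => y [xy py alty].
rewrite negbK in alty.
have [||||lt eqn] := IH k y.+1 => //.
- move=> i yi pi; have := sube i (ltnW (leq_ltn_trans loa (ltn_trans xy yi))) pi.
  by rewrite inE => /orP[/eqP ix|//]; move: yi; rewrite ix; lia.
- by move=> i yi; apply: subf; apply: ltnW (leq_ltn_trans loa (ltn_trans xy yi)).
(* [ye] puts [y] before the first element of the tail, so [y] fills the first gap. *)
split=> // -[/eqn[ye ief]]; split=> // -[|i] /= hi; last exact: ief.
have ly : lo <= y := leq_trans loa (ltnW xy).
by exists y; [exact: subf | rewrite xy].
Qed.

(** * From ordered hypergraphs to set systems embedded on the moment curve *)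

Definition ords n (e : {set 'I_n}) : seq nat := map val (enum e).

Lemma mem_ords n (e : {set 'I_n}) (v : 'I_n) : (val v \in ords e) = (v \in e).
Proof. by rewrite mem_map ?mem_enum //; exact: val_inj. Qed.

Lemma sorted_ords n (e : {set 'I_n}) : sorted ltn (ords e).
Proof.
apply: (subseq_sorted ltn_trans) (iota_ltn_sorted 0 n).
by rewrite -val_enum_ord; apply: map_subseq; rewrite enumT; exact: filter_subseq.
Qed.

Lemma ords_mem n (s : seq nat) : sorted ltn s -> all (gtn n) s ->
  ords [set v : 'I_n | val v \in s] = s.
Proof.
move=> ss /allP sn; apply: (irr_sorted_eq ltn_trans ltnn) => //.
  exact: sorted_ords.
move=> x; apply/mapP/idP => [[v]|xs].
  by rewrite mem_enum inE => ? ->.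
by exists (Ordinal (sn x xs)); rewrite // mem_enum inE.
Qed.

Definition edges_of n (F : seq nat -> Prop) : {set {set 'I_n}} :=
  [set e | `[< F (ords e) >]].

Lemma mem_edges_of n F (e : {set 'I_n}) : e \in edges_of n F -> F (ords e).
Proof. by rewrite inE => /asboolP. Qed.

Lemma edges_of_uniform d n N F : ordered_uniform d N F -> uniform d (edges_of n F).
Proof.
move=> FU e /mem_edges_of /FU[_ + _].
by rewrite size_map -cardE.
Qed.

(** The exponents start at 1; the moment of order 0 is the sum of the weights in an affine
    dependence. *)
Definition moment_curve n D : 'I_n -> point D :=
  fun v j => ((val v)%:R ^+ (val j).+1 : R)%R.

Lemma RsumE (I : finType) (A : {set I}) (F : I -> R) :
  \big[Rplus/R0]_(i in A) F i = (\sum_(i in A) F i)%R.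
Proof. by []. Qed.

Lemma sum_support (I : finType) (A : {set I}) (F : I -> R) :
  (forall i, i \notin A -> F i = 0%R) -> (\sum_(i in A) F i = \sum_i F i)%R.
Proof.
move=> F0; rewrite big_mkcond; apply: eq_bigr => i _.
by case: ifPn => // /F0 ->.
Qed.

(* A non-zero vector annihilated by the moments of order at most 2d - 3 has 2d - 1
   alternations of sign, so one of the two sign classes has d elements and the
   other one meets each gap between them. *)
Lemma interlace_free_moments d N F n (e f : {set 'I_n}) (nu : 'I_n -> R) :
  2 < d -> ordered_uniform d N F -> interlace_free F -> F (ords e) -> F (ords f) ->
  (\sum_v nu v = 0)%R ->
  (forall j : 'I_(2 * d - 3), \sum_v nu v * moment_curve v j = 0)%R ->
  (forall v, 0 < nu v -> v \in e)%R -> (forall v, nu v < 0 -> v \in f)%R ->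
  forall v, nu v = 0%R.
Proof.
move=> d2 FU FI Fe Ff s0 sj pe nf v0; apply: contrapT => /eqP nz.
pose mu i : R := if insub i is Some v then nu v else 0%R.
have muE (v : 'I_n) : mu v = nu v by rewrite /mu valK.
have mu_ord i : mu i != 0%R -> exists v : 'I_n, i = v.
  by rewrite /mu; case: insubP => [v _ <-|_]; [exists v | rewrite eqxx].
have [j|| b alt] := @moments_alternates R n (2 * d - 3) mu.
- case: j => [|j] jd.
    by rewrite -[RHS]s0; apply: eq_bigr => v _; rewrite muE expr0 mulr1.
  by rewrite -[RHS](sj (Ordinal jd)); apply: eq_bigr => v _; rewrite muE.
- by exists (nat_of_ord v0) => //; rewrite muE.
have Dd : (2 * d - 3).+2 = (d.-1).*2.+1 by rewrite -muln2; lia.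
rewrite Dd in alt.
have mem_pos i (c : bool) : (0 < (-1) ^+ c * mu i)%R ->
    i \in ords (if c then f else e).
  move=> h; have [|v Dv] := mu_ord i.
    by apply/eqP => E; rewrite E mulr0 ltxx in h.
  subst i; rewrite mem_ords; case: c h; rewrite muE ?expr1 ?expr0 ?mul1r ?mulN1r.
    by rewrite oppr_gt0 => /nf.
  by move=> /pe.
have [||_] := alternates_interlaces (e := ords (if b then f else e))
   (f := ords (if b then e else f)) (sorted_ords _) _ _ alt.
- by move=> i _; exact: mem_pos.
- by move=> i _ /mem_pos; case: (b).
have Fb c : F (ords (if c then f else e)) by case: c.
have [_ -> _] := FU _ (Fb b).
rewrite prednK; last lia; move=> /(_ erefl)[_].
by apply: FI => //; case: (b).
Qed.

(** Affine independence is the case of one edge against itself. For two edges, the difference of two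
    convex representations of a point is positive only on [e1] and negative only on [e2], so it
    vanishes and the common weights live on [e1 :&: e2]. *)
Lemma edges_of_embedding d N F n :
  2 < d -> ordered_uniform d N F -> interlace_free F ->
  lin_embedding (edges_of n F) (@moment_curve n (2 * d - 3)).
Proof.
move=> d2 FU FI; split=> [e|e1 e2] /mem_edges_of Fe.
  move=> mu mu0 muj v ve.
  pose nu v := if v \in e then mu v else 0%R.
  suff : nu v = 0%R by rewrite /nu ve.
  have nz w : (nu w != 0)%R -> w \in e by rewrite /nu; case: ifP => //; rewrite eqxx.
  apply: (interlace_free_moments d2 FU FI Fe Fe).
  - by rewrite -[RHS]mu0 RsumE [RHS]big_mkcond.
  - move=> j; rewrite -[RHS](muj j) RsumE [RHS]big_mkcond.
    by apply: eq_bigr => w _; rewrite /nu; case: ifP => // _; rewrite mul0r.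
  - by move=> w h; apply: nz; rewrite gt_eqF.
  - by move=> w h; apply: nz; rewrite lt_eqF.
move=> /mem_edges_of Ff x; split; last first.
  move=> [lam [l0 [lN [l1 lx]]]].
  have sub (e : {set _}) : e1 :&: e2 \subset e -> in_conv (@moment_curve n (2 * d - 3)) e x.
    move=> /subsetP sub.
    have lNe v : v \notin e -> lam v = 0%R.
      by move=> ve; apply: lN; apply: contra ve => /sub.
    exists lam; do 2!split=> //; split.
      by rewrite -[RHS]l1 !RsumE !sum_support.
    move=> j; rewrite lx !RsumE !sum_support // => v h; first by rewrite lNe // Rmult_0_l.
    by rewrite lN // Rmult_0_l.
  by split; apply: sub; rewrite ?subsetIl ?subsetIr.
move=> [[lam [l0 [lN [l1 lx]]]] [mu [m0 [mN [m1 mx]]]]].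
have zlam (j : 'I_(2 * d - 3)) v : v \notin e1 -> Rmult (lam v) (moment_curve v j) = 0%R.
  by move=> h; rewrite lN // Rmult_0_l.
have zmu (j : 'I_(2 * d - 3)) v : v \notin e2 -> Rmult (mu v) (moment_curve v j) = 0%R.
  by move=> h; rewrite mN // Rmult_0_l.
have {}l0 v : (0 <= lam v)%R by apply/RleP.
have {}m0 v : (0 <= mu v)%R by apply/RleP.
have eqlm v : lam v = mu v.
  apply/eqP; rewrite -subr_eq0; apply/eqP; move: v.
  apply: (interlace_free_moments d2 FU FI Fe Ff).
  - rewrite sumrB -(sum_support lN) -(sum_support mN) -!RsumE l1 m1.
    exact: subrr.
  - move=> j; under eq_bigr do rewrite mulrBl.
    rewrite sumrB -(sum_support (zlam j)) -(sum_support (zmu j)) -!RsumE -lx -mx.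
    exact: subrr.
  - move=> v h; apply: contraTT h => /lN ->.
    by rewrite sub0r oppr_gt0 -leNgt.
  - move=> v h; apply: contraTT h => /mN ->.
    by rewrite subr0 -leNgt.
exists lam; split; first by move=> v; apply/RleP.
have lI v : v \notin e1 :&: e2 -> lam v = 0%R.
  by rewrite inE negb_and => /orP[/lN //|/mN]; rewrite eqlm.
split=> //; split; first by rewrite -[RHS]l1 !RsumE !sum_support.
move=> j; rewrite lx !RsumE !sum_support //; last exact: zlam.
by move=> v h; rewrite lI // Rmult_0_l.
Qed.

(** If [c <= C], the colors below [c] form a palette small enough to force a monochromatic edge. *)
Lemma edges_of_colors C N n F c (kappa : 'I_n -> 'I_c) : N <= n ->
  (forall e, F e -> sorted ltn e /\ all (gtn N) e) -> forces_mono C N F ->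
  weak_coloring (edges_of n F) kappa -> C < c.
Proof.
move=> Nn Fs FC wk; rewrite ltnNge; apply/negP => cC.
pose kap i : nat := if insub i is Some v then kappa v else 0.
have kapE (v : 'I_n) : kap v = kappa v by rewrite /kap valK.
have [||e [k [Fe mono]]] := FC kap (iota 0 c).
- by rewrite size_iota.
- move=> v vN; rewrite -[v]/(val (Ordinal (leq_trans vN Nn))) kapE.
  by rewrite mem_iota /= ltn_ord.
have [se aeN] := Fs e Fe.
have aen : all (gtn n) e.
  by apply: sub_all aeN => i iN; apply: leq_trans Nn.
have [|u [v [ue [ve]]]] := wk [set v : 'I_n | val v \in e].
  by rewrite inE ords_mem //; apply/asboolP.
apply; apply: val_inj; move: ue ve; rewrite !inE => ue ve.
rewrite /= -!kapE.
by rewrite (eqP (allP mono _ ue)) (eqP (allP mono _ ve)).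
Qed.

(** * Asymptotics *)

(** With L = ln n, taking logarithms gives L <= k (ln A + 2 ln k). If k < L, both logarithms are at
    most ln L, whence the factor 3; if L <= k, it suffices that ln L >= 1. *)
Lemma log_ratio_le A (k n : nat) : (1 <= A)%coq_nat -> (0 < k)%coq_nat -> (0 < n)%coq_nat ->
  (3 <= ln (INR n))%Re -> (INR A <= ln (INR n))%Re ->
  (n <= (A * k ^ 2) ^ k)%coq_nat ->
  (/ 3 * ln (INR n) / ln (ln (INR n)) <= INR k)%Re.
Proof.
move=> A1 k0 n_gt0; set L := ln (INR n) => L3 LA nk.
have ln3 : (1 <= ln 3)%Re.
  have := exp_le_3 => e3; rewrite -{1}(ln_exp 1).
  by case: e3 => [h|->]; [left; apply: ln_increasing => //; exact: exp_pos | right].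
have lnL : (1 <= ln L)%Re.
  apply: Rle_trans ln3 _; case: L3 => [h|->]; last by right.
  by left; apply: ln_increasing => //; Lra.lra.
have kR : (1 <= INR k)%Re by exact: (le_INR 1 _ _).
have AR : (1 <= INR A)%Re by exact: (le_INR 1 _ _).
have ln_le x y : (0 < x -> x <= y -> ln x <= ln y)%Re.
  by move=> x0 [h|->]; [left; apply: ln_increasing | right].
apply: (Rmult_le_reg_r (ln L)); first by Lra.lra.
rewrite /Rdiv Rmult_assoc Rinv_l ?Rmult_1_r; last by Lra.lra.
suff : (L <= INR k * (3 * ln L))%Re by Lra.lra.
have [Lk|kL] := Rle_or_lt L (INR k).
  by have : (INR k * 1 <= INR k * (3 * ln L))%Re; [apply: Rmult_le_compat_l; Lra.lra | Lra.lra].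
have n0 : (0 < INR n)%Re by exact: lt_0_INR.
have main : (L <= INR k * (ln (INR A) + 2 * ln (INR k)))%Re.
  have := le_INR _ _ nk.
  have powE a b : INR (a ^ b) = (INR a ^ b)%Re.
    by elim: b => // b IH; rewrite expnS mult_INR IH.
  rewrite powE mult_INR powE => h.
  have pos2 : (0 < INR A * INR k ^ 2)%Re.
    by apply: Rmult_lt_0_compat; [Lra.lra | apply: pow_lt; Lra.lra].
  have k2 : (0 < INR k ^ 2)%Re by apply: pow_lt; Lra.lra.
  have := ln_le _ _ n0 h; rewrite -/L ln_pow // ln_mult //; last by Lra.lra.
  by rewrite ln_pow //; Lra.lra.
have lnA := ln_le _ _ (Rlt_le_trans _ _ _ Rlt_0_1 AR) LA.
have lnk : (ln (INR k) <= ln L)%Re by apply: ln_le; Lra.lra.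
apply: Rle_trans main _; apply: Rmult_le_compat_l; Lra.lra.
Qed.

Theorem mainTheorem17 (d : nat) (hd : 3 <= d) :
  exists (c : R) (n0 : nat), Rlt 0 c /\
    forall n : nat, n0 <= n ->
      exists E : {set {set 'I_n}},
        embeddable (2 * d - 3) d E /\
        weak_chi_ge E (Rdiv (Rmult c (ln (INR n))) (ln (ln (INR n)))).
Proof.
case: d hd => [//|[//|q]]; rewrite !ltnS => q0.
pose A := 2 * q.+2 ^ 2.
(* This threshold makes ln n exceed both 3 and [A], as [log_ratio_le] requires. *)
have [n0 n0_large] := INR_unbounded (exp (3 + INR A)).
exists (/ 3)%Re, n0; split; first by Lra.lra.
move=> n le_n0n; have n_large : (exp (3 + INR A) < INR n)%Re.
  by apply: Rlt_le_trans n0_large _; apply: le_INR; apply/ssrnat.leP.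
have L_large : (3 + INR A < ln (INR n))%Re.
  by rewrite -(ln_exp (3 + INR A)); apply: ln_increasing n_large; exact: exp_pos.
have n_gt0 : 0 < n.
  by apply/ssrnat.ltP; apply: INR_lt; exact: (Rlt_trans _ _ _ (exp_pos _) n_large).
have [C /andP[leCn ltnC]] := order_of_bracket q n_gt0.
have [FU FI FC] := hyperP C q0.
exists (edges_of n (hyper q C)); split.
  split; first exact: edges_of_uniform FU.
  by exists (@moment_curve n (2 * q.+2 - 3)); exact: edges_of_embedding FU FI.
move=> c kappa /(edges_of_colors leCn _ FC) Cc.
have {}Cc : C < c by apply: Cc => e /FU[].
have A_ge0 := pos_INR A.
(* The estimate is applied with [k = C.+1], since [n] is below the order of level [C.+1]; this costs
   nothing because [C < c]. *)
apply: (@Rle_trans _ (INR C.+1)); last by apply: le_INR; apply/ssrnat.leP.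
apply: (@log_ratio_le A) => //; try Lra.lra.
- by apply/ssrnat.leP; rewrite muln_gt0 expn_gt0.
- exact/ssrnat.ltP.
- exact/ssrnat.ltP.
- by apply/ssrnat.leP; apply: ltnW; apply: leq_trans ltnC (order_of_le q C.+1).
Qed.
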